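(* Let $N\ge 2$, let $K\in\mathcal K^{ss}_{(o)}$ and let $0<R\le\infty$. Assume that $A,B,H\in C^1(0,R)$ and $H=AB$. Then, for every $u\in C_c^\infty(B_R^K\setminus\{o\})$, $$\int_{B_R^K}A^2\,|\mathcal R_K(u)|^2\,dx=\int_{B_R^K}\Big[\operatorname{div}\big(H(\|x\|_K)\,\sigma_K(x)\big)-B^2\Big]u^2\,dx+\int_{B_R^K}\big|A\,\mathcal R_K(u)+B\,u\big|^2\,dx,$$ where $A$ and $B$ under the integrals are evaluated at $\|x\|_K$.
   Context: $N\ge2$ is an integer and $o$ is the origin of $\mathbb R^N$. A convex body is a compact convex subset of $\mathbb R^N$ with non-empty interior. $\mathcal K^{ss}_{(o)}$ is the set of convex bodies $K\subset\mathbb R^N$ that contain $o$ in their interior, are smooth (each boundary point has a unique outer unit normal vector) and strictly convex ($\partial K$ contains no line segment). $K$ is not assumed origin-symmetric. The Minkowski functional of $K$ is $\|x\|_K=\inf\{\lambda\ge0: x\in\lambda K\}$. For $x\ne o$, $\sigma_K(x)=x/\|x\|_K$, and the anisotropic radial derivative is $\mathcal R_K(u)(x)=\nabla u(x)\cdot\sigma_K(x)=\frac{x\cdot\nabla u(x)}{\|x\|_K}$. For $0<R\le\infty$, $B_R^K=\{x\in\mathbb R^N:\|x\|_K<R\}$. $C^1(0,R)$ is the set of real functions on $(0,R)$ with continuous first derivative, and $C_c^\infty(\Omega)$ is the set of real-valued smooth functions with compact support in $\Omega$. *)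

(* Defs.v *)
From HB Require Import structures.
From mathcomp Require Import all_boot all_order all_algebra.
From mathcomp Require Import all_classical all_reals all_analysis.

Set Implicit Arguments.
Unset Strict Implicit.
Unset Printing Implicit Defensive.

Import Order.TTheory GRing.Theory Num.Theory.
Import numFieldNormedType.Exports.

Local Open Scope classical_set_scope.
Local Open Scope ring_scope.

(* 'rV[R]_n carries the sigma-algebra generated by the coordinates, as n.-tuple
   does in the library; it coincides with the Borel sigma-algebra. *)
Definition rV_display : measure_display -> measure_display.
Proof. exact. Qed.

Section measurable_rV.
Context {R : realType} (n : nat).

Let coors : 'I_n -> 'rV[R]_n -> measurableTypeR R := fun i x => x ord0 i.

Let rV_set0 : g_sigma_preimage coors set0.
Proof. exact: sigma_algebra0. Qed.

Let rV_setC A : g_sigma_preimage coors A -> g_sigma_preimage coors (~` A).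
Proof. exact: sigma_algebraC. Qed.

Let rV_bigcup (F : _^nat) : (forall i, g_sigma_preimage coors (F i)) ->
  g_sigma_preimage coors (\bigcup_i (F i)).
Proof. exact: sigma_algebra_bigcup. Qed.

HB.instance Definition _ := @isMeasurable.Build (rV_display default_measure_display)
  'rV[R]_n (g_sigma_preimage coors) rV_set0 rV_setC rV_bigcup.

End measurable_rV.

Section measurable_fun_rV.
Context {R : realType}.

Lemma measurable_coord n (i : 'I_n) :
  measurable_fun [set: 'rV[R]_n] (fun x : 'rV[R]_n => x ord0 i : measurableTypeR R).
Proof.
move=> _ Y mY; rewrite setTI; apply: sub_sigma_algebra => /=.
rewrite -bigcup_seq/=; exists i => /=; first by rewrite mem_index_enum.
by exists Y => //; rewrite setTI.
Qed.

Lemma measurable_fun_rVP d (T : measurableType d) n (f : T -> 'rV[R]_n) :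
  (forall i, measurable_fun [set: T] (fun t => f t ord0 i : measurableTypeR R)) ->
  measurable_fun [set: T] f.
Proof.
move=> mf _ A mA; rewrite setTI.
suff: preimage_set_system [set: T] f measurable `<=` measurable.
  by apply; exists A => //; rewrite setTI.
move=> _ [B mB <-]; rewrite setTI.
have : preimage_set_system [set: T] f
    (g_sigma_preimage (fun i (x : 'rV[R]_n) => x ord0 i : measurableTypeR R))
    (f @^-1` B) by exists B => //; rewrite setTI.
rewrite -g_sigma_preimage_comp; move: (f @^-1` B).
apply: smallest_sub; first exact: sigma_algebra_measurable.
move=> C; rewrite -bigcup_seq => -[i _ [D mD <-]].
exact: mf.
Qed.

Definition rV_cons n (p : measurableTypeR R * 'rV[R]_n) : 'rV[R]_n.+1 :=
  \row_i (if unlift ord0 i is Some j then p.2 ord0 j else p.1).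

Definition rV_uncons n (x : 'rV[R]_n.+1) : measurableTypeR R * 'rV[R]_n :=
  (x ord0 ord0, \row_j x ord0 (lift ord0 j)).

Lemma rV_consK n : cancel (@rV_cons n) (@rV_uncons n).
Proof.
move=> [a v]; rewrite /rV_uncons mxE unlift_none; congr pair.
by apply/rowP => j; rewrite !mxE liftK.
Qed.

Lemma rV_unconsK n : cancel (@rV_uncons n) (@rV_cons n).
Proof.
move=> x; apply/rowP => i; rewrite !mxE.
by case: unliftP => [j|] ->; rewrite ?mxE.
Qed.

Lemma measurable_rV_cons n : measurable_fun setT (@rV_cons n).
Proof.
apply: measurable_fun_rVP => i.
case: (unliftP ord0 i) => [j|] ->.
  under eq_fun do rewrite mxE liftK.
  exact: measurableT_comp (measurable_coord j) measurable_snd.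
under eq_fun do rewrite mxE unlift_none.
exact: measurable_fst.
Qed.

Lemma measurable_rV_uncons n : measurable_fun setT (@rV_uncons n).
Proof.
apply: measurable_fun_pair; first exact: measurable_coord.
apply: measurable_fun_rVP => j.
under eq_fun do rewrite mxE.
exact: measurable_coord.
Qed.

End measurable_fun_rV.

Section lebesgue_rV.
Context {R : realType}.
Local Open Scope ereal_scope.

Definition rV_prod n (mu : {sigma_finite_measure set 'rV[R]_n -> \bar R}) :
  set 'rV[R]_n.+1 -> \bar R :=
  pushforward (lebesgue_measure \x mu) (@rV_cons R n).

Section rV_prod.
Variables (n : nat) (mu : {sigma_finite_measure set 'rV[R]_n -> \bar R}).

Let rV_prod0 : rV_prod mu set0 = 0.
Proof. by rewrite /rV_prod /pushforward preimage_set0 measure0. Qed.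

Let rV_prod_ge0 A : 0 <= rV_prod mu A.
Proof. by rewrite /rV_prod /pushforward; exact: measure_ge0. Qed.

Let rV_prod_semi_sigma_additive : semi_sigma_additive (rV_prod mu).
Proof.
move=> F mF tF mUF; rewrite /rV_prod /pushforward preimage_bigcup.
have mcons A : measurable A -> measurable (@rV_cons R n @^-1` A).
  by move=> mA; rewrite -[X in measurable X]setTI; exact: measurable_rV_cons.
apply: measure_semi_sigma_additive.
- by move=> k; exact: mcons.
- apply/trivIsetP => /= i j _ _ ij; rewrite -preimage_setI.
  by move/trivIsetP : tF => /(_ _ _ _ _ ij) ->//; rewrite preimage_set0.
- by rewrite -preimage_bigcup; exact: mcons.
Qed.

HB.instance Definition _ := isMeasure.Build _ _ _
  (rV_prod mu) rV_prod0 rV_prod_ge0 rV_prod_semi_sigma_additive.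

Let rV_prod_sigma_finite : sigma_finite setT (rV_prod mu).
Proof.
have /sigma_finiteP[F [TF ndF Foo]] := sigma_finiteT (@lebesgue_measure R).
have /sigma_finiteP[G [TG ndG Goo]] := sigma_finiteT mu.
exists (fun k => @rV_uncons R n @^-1` (F k `*` G k)).
  rewrite -preimage_bigcup; apply/esym/seteqP; split => // x _ /=.
  have [i _ Fi] : (\bigcup_i F i) (rV_uncons x).1 by rewrite -TF.
  have [j _ Gj] : (\bigcup_j G j) (rV_uncons x).2 by rewrite -TG.
  exists (maxn i j) => //; split.
  - by move: Fi; exact/subsetPset/ndF/leq_maxl.
  - by move: Gj; exact/subsetPset/ndG/leq_maxr.
move=> k; have [mFk Fkoo] := Foo k; have [mGk Gkoo] := Goo k; split.
  by rewrite -[X in measurable X]setTI; apply: measurable_rV_uncons => //;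
    exact: measurableX.
rewrite /rV_prod /pushforward -comp_preimage.
have /funext -> : @rV_uncons R n \o @rV_cons R n =1 id by exact: rV_consK.
by rewrite preimage_id product_measure1E// lte_mul_pinfty// ge0_fin_numE.
Qed.

HB.instance Definition _ :=
  @Measure_isSigmaFinite.Build _ _ _ (rV_prod mu) rV_prod_sigma_finite.

End rV_prod.

(* N-dimensional Lebesgue measure on Borel sets, as an iterated product of the
   one-dimensional one; lebesgue_rV_prod gives its values on product sets. *)
Fixpoint lebesgue_rV n : {sigma_finite_measure set 'rV[R]_n -> \bar R} :=
  if n is m.+1 then rV_prod (lebesgue_rV m) else dirac (0 : 'rV[R]_0)%R.

Lemma lebesgue_rV_prod n (A : 'I_n -> set (measurableTypeR R)) :
  (forall i, measurable (A i)) ->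
  lebesgue_rV n [set x | forall i, A i (x ord0 i)] =
  \prod_(i < n) lebesgue_measure (A i).
Proof.
elim: n A => [|n IHn] A mA /=.
  by rewrite big_ord0 diracE mem_set// => -[].
have mtail : measurable
    [set x : 'rV[R]_n | forall i, A (lift ord0 i) (x ord0 i)].
  rewrite (_ : mkset _ = \big[setI/setT]_(i < n)
      ((fun x : 'rV[R]_n => x ord0 i) @^-1` A (lift ord0 i))).
    apply: bigsetI_measurable => i _; rewrite -[X in measurable X]setTI.
    exact: measurable_coord.
  rewrite -bigcap_seq; apply/seteqP; split => x /= Ax i.
    by move=> _; exact: Ax.
  by apply: (Ax i); rewrite /= mem_index_enum.
rewrite big_ord_recl -IHn// -product_measure1E// /rV_prod /pushforward.
congr (_ _); apply/seteqP; split => -[a v] /=.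
  move=> Aav; split; first by have := Aav ord0; rewrite mxE unlift_none.
  by move=> i; have := Aav (lift ord0 i); rewrite mxE liftK.
by move=> [Aa Av] i; rewrite mxE; case: unliftP => [j|] ->.
Qed.

End lebesgue_rV.

Section euclidean.
Context {R : realType} {N : nat}.
Local Notation V := 'rV[R]_N.
Implicit Types (x y nu : V) (K Omega : set V) (u : V -> R) (F : V -> V).

Definition dotv x y : R := \sum_(i < N) x ord0 i * y ord0 i.

Definition basis_vec (i : 'I_N) : V := delta_mx ord0 i.

Definition partial (i : 'I_N) u : V -> R := fun x => 'D_(basis_vec i) u x.

Definition gradient u x : V := \row_(i < N) partial i u x.

Definition divergence F x : R := \sum_(i < N) partial i (fun y => F y ord0 i) x.

Fixpoint class_Ck (k : nat) u : Prop :=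
  continuous u /\
  if k is k'.+1 then
    (forall x i, derivable u x (basis_vec i)) /\
    (forall i, class_Ck k' (partial i u))
  else True.

Definition support_of u : set V := closure [set x | u x != 0].

(* A function in C_c^oo(Omega) is represented by its extension by 0 to the
   whole space. *)
Definition Cc_infty Omega u : Prop :=
  [/\ forall k, class_Ck k u, compact (support_of u) & support_of u `<=` Omega].

Definition boundary K : set V := closure K `\` interior K.

Definition segment x y : set V :=
  [set (1 - t) *: x + t *: y | t in `[0, 1]%classic].

Definition convex_body K : Prop :=
  [/\ @convex_set R V K, compact K & interior K !=set0].

Definition outer_unit_normal K x nu : Prop :=
  dotv nu nu = 1 /\ forall y, K y -> dotv (y - x) nu <= 0.

Definition smooth_body K : Prop :=
  forall x, boundary K x -> exists! nu, outer_unit_normal K x nu.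

Definition strictly_convex_body K : Prop :=
  forall x y, x <> y -> ~ (segment x y `<=` boundary K).

Definition Kss_o K : Prop :=
  [/\ convex_body K, interior K 0, smooth_body K & strictly_convex_body K].

Definition minkowski_functional K x : R :=
  inf [set l : R | 0 <= l /\ [set l *: y | y in K] x].

(* The junk value at x = 0 is 0. *)
Definition sigma_body K x : V := (minkowski_functional K x)^-1 *: x.

Definition radial_derivative K u x : R := dotv (gradient u x) (sigma_body K x).

Definition body_ball K (rho : \bar R) : set V :=
  [set x | ((minkowski_functional K x)%:E < rho)%E].

End euclidean.

(* A function in C^1(0, rho) is represented by an arbitrary extension to R. *)
Definition C1_on (R : realType) (rho : \bar R) (f : R -> R) : Prop :=
  forall r : R, 0 < r -> (r%:E < rho)%E ->
    derivable f r 1 /\ {for r, continuous (derive1 f)}.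

(* Main.v *)
Require Import Defs.
From mathcomp Require Import all_boot all_order all_algebra.
From mathcomp Require Import all_classical all_reals all_analysis.
From mathcomp Require Import ring lra measurable_realfun.

Set Implicit Arguments.
Unset Strict Implicit.
Unset Printing Implicit Defensive.

Import Order.TTheory GRing.Theory Num.Theory.
Import numFieldNormedType.Exports.

Local Open Scope classical_set_scope.
Local Open Scope ring_scope.

(** Write g for the Minkowski functional of K and phi r = H r / r. Since
    R_K u = (x . grad u) / g and H = A B, expanding the square in the last
    integral shows that the identity says precisely that

      div (H(g) sigma_K) u^2 + 2 phi(g) u (x . grad u)

    has integral zero. The vector field here is H(g) sigma_K = phi(g) x, a
    radial field, and this suggests to use dilations rather than a coordinatewise
    integration by parts.

    First, the divergence is a function of g alone: as soon as g has a gradient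
    away from the origin, Euler's relation x . grad g = g turns
    div (phi(g) x) into N phi(g) + g phi'(g) ([divergence_radial]). The gradient
    exists because K is smooth: the one-sided directional derivatives of the
    sublinear function g at x are the suprema of the values of its subgradients
    (a finite-dimensional Hahn-Banach argument, [sublinear_subgradient]), every
    subgradient at x is an outer normal of K at x / g(x) normalised by
    p . x = g(x), so there is only one, and the one-sided derivatives match
    ([gauge_is_derive]).

    Secondly, with f = phi(g) u^2 the displayed function is N f + x . grad f.
    This is the derivative at t = 1 of t^N f(t x), and the integral of
    t^N f(t x) over the whole space does not depend on t > 0, because Lebesgue
    measure scales by t^N ([integral_dilation]). Differentiating under the
    integral sign, by dominated convergence of difference quotients, gives zero
    ([integral_dilation_derivative]). Only derivatives along the rays from the
    origin occur, and along a ray g is linear.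

    All functions involved are continuous and vanish off the support of u, a
    compact subset of the ball minus its centre, so that measurability and
    integrability follow, and the integrals over the ball become integrals over
    the whole space. *)

(** * Lebesgue measure under dilations *)

Section scaling.
Context {R : realType}.
Local Open Scope ereal_scope.

Lemma measurable_mulrl (c : R) :
  measurable_fun setT ( *%R c : measurableTypeR R -> measurableTypeR R).
Proof. by apply: continuous_measurable_fun; exact: mulrl_continuous. Qed.

Lemma measurable_rV_scale n (c : R) :
  measurable_fun setT (fun x : 'rV[R]_n => c *: x)%R.
Proof.
apply: measurable_fun_rVP => i.
under eq_fun do rewrite mxE.
exact: measurableT_comp (measurable_mulrl c) (measurable_coord i).
Qed.

Lemma rV_cons_scale n (c a : R) (v : 'rV[R]_n) :
  (c *: rV_cons (a, v) = rV_cons (c * a, c *: v))%R.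
Proof. by apply/rowP => i; rewrite !mxE; case: unliftP => [j|] _; rewrite ?mxE. Qed.

Lemma lebesgue_measure_dilation (c : R) (c0 : (0 < c)%R) (A : set (measurableTypeR R)) :
  measurable A ->
  lebesgue_measure A = pushforward (mscale (NngNum (ltW c0)) lebesgue_measure)
    ( *%R c : measurableTypeR R -> measurableTypeR R) A.
Proof.
move=> mA.
have mc := measurable_mulrl c.
apply: lebesgue_measure_unique => //= _ [[a b]] _ <-.
rewrite /mscale /pushforward /=.
have -> : *%R c @^-1` `]a, b]%classic = `](a / c)%R, (b / c)%R]%classic.
  by apply/seteqP; split => x /=; rewrite !in_itv/= ltr_pdivrMr// ler_pdivlMr// mulrC.
rewrite !lebesgue_measure_itv/= !lte_fin ltr_pM2r ?invr_gt0//.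
case: ifPn => _; last by rewrite mule0.
by rewrite -EFinB -EFinM -mulrBl mulrC divfK ?gt_eqF.
Qed.

Lemma ge0_integral_dilation1 (c : R) (f : measurableTypeR R -> \bar R) : (0 < c)%R ->
  measurable_fun setT f -> (forall x, 0 <= f x) ->
  c%:E * \int[lebesgue_measure]_x f (c * x)%R = \int[lebesgue_measure]_x f x.
Proof.
move=> c0 mf f0.
rewrite [RHS](eq_measure_integral
    (pushforward (mscale (NngNum (ltW c0)) lebesgue_measure)
      ( *%R c : measurableTypeR R -> measurableTypeR R))); last first.
  by move=> A mA _; exact: lebesgue_measure_dilation.
have mc := measurable_mulrl c.
rewrite ge0_integral_pushforward//= preimage_setT ge0_integral_mscale//=.
exact: measurableT_comp.
Qed.

Lemma ge0_integral_rV_prod n (mu : {sigma_finite_measure set 'rV[R]_n -> \bar R})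
    (f : 'rV[R]_n.+1 -> \bar R) : measurable_fun setT f -> (forall x, 0 <= f x) ->
  \int[rV_prod mu]_x f x =
  \int[lebesgue_measure]_a \int[mu]_v f (rV_cons (a, v)).
Proof.
move=> mf f0; have mc := @measurable_rV_cons R n.
rewrite /rV_prod ge0_integral_pushforward//= preimage_setT.
rewrite (fubini_tonelli1 (f \o @rV_cons R n))//=.
exact: measurableT_comp mf mc.
Qed.

(** Induction on the dimension: Tonelli reduces one more coordinate to the
    one-dimensional case applied to the inner integral. *)
Lemma ge0_integral_dilation n (c : R) (f : 'rV[R]_n -> \bar R) : (0 < c)%R ->
  measurable_fun setT f -> (forall x, 0 <= f x) ->
  (c ^+ n)%:E * \int[lebesgue_rV n]_x f (c *: x)%R = \int[lebesgue_rV n]_x f x.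
Proof.
move=> c0; elim: n f => [f mf f0|n IHn f mf f0] /=.
  rewrite expr0 mul1e; apply: eq_integral => x _; congr f.
  by apply/rowP => -[].
have mfc : measurable_fun setT (fun x : 'rV[R]_n.+1 => f (c *: x)%R).
  exact: measurableT_comp mf (measurable_rV_scale c).
have mF (g : 'rV[R]_n.+1 -> \bar R) : measurable_fun setT g -> (forall x, 0 <= g x) ->
    measurable_fun setT (fun a : measurableTypeR R =>
      \int[lebesgue_rV n]_v g (rV_cons (a, v))).
  move=> mg g0; apply: (measurable_fun_fubini_tonelli_F (g \o @rV_cons R n)) => //=.
  exact: measurableT_comp mg (@measurable_rV_cons R n).
rewrite !ge0_integral_rV_prod//.
rewrite -[RHS](ge0_integral_dilation1 c0 (mF _ mf f0)); last first.
  by move=> x; exact: integral_ge0.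
rewrite exprS EFinM -muleA; congr (_ * _).
rewrite -ge0_integralZl//; last 3 first.
- exact: mF mfc _.
- by move=> x _; exact: integral_ge0.
- by rewrite lee_fin exprn_ge0// ltW.
apply: eq_integral => a _.
under eq_integral do rewrite rV_cons_scale.
rewrite (IHn (fun v => f (rV_cons ((c * a)%R, v))))//.
apply: (@measurableT_comp _ _ _ _ _ _ f) => //.
apply: (@measurableT_comp _ _ _ _ _ _ (@rV_cons R n)); first exact: measurable_rV_cons.
exact: measurable_fun_pair.
Qed.

Lemma integral_dilation n (c : R) (f : 'rV[R]_n -> \bar R) : (0 < c)%R ->
  (lebesgue_rV n).-integrable setT f ->
  (c ^+ n)%:E * \int[lebesgue_rV n]_x f (c *: x)%R = \int[lebesgue_rV n]_x f x.
Proof.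
move=> c0 intf; have mf : measurable_fun setT f by case/integrableP : intf.
have scaleV (g : 'rV[R]_n -> \bar R) : measurable_fun setT g ->
    (forall x, 0 <= g x) ->
    \int[lebesgue_rV n]_x g (c *: x)%R = (c^-1 ^+ n)%:E * \int[lebesgue_rV n]_x g x.
  move=> mg g0; rewrite -(ge0_integral_dilation c0 mg g0) muleA -EFinM.
  by rewrite exprVn mulVf ?mul1e// expf_neq0// gt_eqF.
rewrite [in LHS]integralE [RHS]integralE.
rewrite (funepos_comp f ( *:%R c)) (funeneg_comp f ( *:%R c)).
rewrite !scaleV//; [|exact: measurable_funeneg|exact: measurable_funepos].
have /fineK <- := integrable_pos_fin_num measurableT intf.
have /fineK <- := integrable_neg_fin_num measurableT intf.
rewrite -!EFinM -!EFinB -mulrBr mulrA -exprMn mulfV ?gt_eqF// expr1n.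
by rewrite mul1r.
Qed.

End scaling.

(** * Continuous functions with compact support *)

Section borel_rV.
Context {R : realType}.

Lemma measurable_rV_box n (A : 'I_n -> set (measurableTypeR R)) :
  (forall i, measurable (A i)) ->
  measurable [set x : 'rV[R]_n | forall i, A i (x ord0 i)].
Proof.
move=> mA; rewrite (_ : mkset _ = \big[setI/setT]_(i < n)
    ((fun x : 'rV[R]_n => x ord0 i) @^-1` A i)).
  apply: bigsetI_measurable => i _; rewrite -[X in measurable X]setTI.
  exact: measurable_coord.
rewrite -bigcap_seq; apply/seteqP; split => x /= Ax i.
  by move=> _; exact: Ax.
by apply: (Ax i); rewrite /= mem_index_enum.
Qed.

Lemma measurable_rV_ball n (x : 'rV[R]_n) (e : R) : measurable (ball x e).
Proof.
have [e0|e0] := ltP 0 e; last first.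
  by rewrite (_ : ball x e = set0) //; apply/seteqP; split => y //= -[]; rewrite ltNge e0.
rewrite (_ : ball x e = [set y | forall i, ball (x ord0 i : R) e (y ord0 i)]).
  apply: (measurable_rV_box (A := fun i => ball (x ord0 i : R) e)) => i.
  by apply: open_measurable; exact: ball_open.
apply/seteqP; split => y /=; first by move=> [_ xy] i; exact: xy.
by move=> xy; split => // i j; rewrite ord1.
Qed.

(** The sigma-algebra is generated by the coordinates; an open set belongs to it
    because it is the countable union of the balls with rational centre and
    radius 1/(k+1) that it contains. *)
Lemma open_measurable_rV n (U : set 'rV[R]_n) : open U -> measurable U.
Proof.
move=> oU.
pose B (p : 'rV[rat]_n * nat) : set 'rV[R]_n :=
  ball (map_mx ratr p.1 : 'rV[R]_n) (p.2.+1%:R^-1).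
have -> : U = \bigcup_p (if `[< B p `<=` U >] then B p else set0).
  apply/seteqP; split => [x Ux|x [p _]]; last by case: asboolP => // + Bx; exact.
  have /nbhs_ballP[e /= e0 xeU] := open_nbhs_nbhs (conj oU Ux).
  have [k ke] : exists k, k.+1%:R^-1 < e / 2.
    have e20 : 0 < e / 2 by rewrite divr_gt0.
    exists (Num.truncn (e / 2)^-1).
    by rewrite invf_plt ?posrE// truncnS_gt.
  pose r : R := k.+1%:R^-1.
  have r0 : 0 < r by rewrite invr_gt0.
  have /choice[q qP] i : exists q : rat, `|x ord0 i - ratr q| < r.
    have [|q] := @rat_in_itvoo R (x ord0 i - r) (x ord0 i + r); first by lra.
    by rewrite in_itv/= => /andP[? ?]; exists q; rewrite ltr_norml; lra.
  have Bx : B (\row_i q i, k) x.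
    split => // i j; rewrite !mxE ord1 /ball /= distrC; exact: qP.
  exists (\row_i q i, k) => //; case: asboolP => // -[] y By; apply: xeU.
  pose c : 'rV[R]_n := map_mx ratr (\row_i q i).
  rewrite [e]splitr; apply: (@ball_triangle _ _ c).
    by apply: ball_sym; exact: le_ball (ltW ke) _ Bx.
  exact: le_ball (ltW ke) _ By.
apply: countable_bigcupT_measurable; first exact: countableP.
by move=> p; case: ifPn => // _; exact: measurable_rV_ball.
Qed.

Lemma continuous_measurable_rV n (f : 'rV[R]_n -> R) :
  continuous f -> measurable_fun setT (f : _ -> measurableTypeR R).
Proof.
move=> /continuousP cf; apply: (measurability _ (RGenOpens.measurableE R)).
move=> _ [_ [a [b ->] <-]]; rewrite setTI; apply: open_measurable_rV.
exact/cf/interval_open.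
Qed.

Lemma rV_coord_norm n (x : 'rV[R]_n) i : `|x ord0 i| <= `|x|.
Proof.
rewrite [leRHS]/Num.norm /= mx_normrE; apply/bigmax_geP; right => /=.
by exists (ord0, i).
Qed.

Definition cube n (C : R) : set 'rV[R]_n :=
  [set x | forall i, x ord0 i \in `[- C, C]].

Lemma measurable_cube n C : measurable (@cube n C).
Proof.
apply: (measurable_rV_box (A := fun=> [set` `[- C, C]])) => i.
exact: measurable_itv.
Qed.

Lemma lebesgue_cube_lty n C : (lebesgue_rV n (cube C) < +oo)%E.
Proof.
rewrite (lebesgue_rV_prod (A := fun=> [set` `[- C, C]]))//.
suff /fin_numPlt/andP[] :
  (\prod_(i < n) lebesgue_measure [set` `[(- C)%R, C%R]])%E \is a fin_num by [].
elim/big_ind : _ => //= [x y|i _]; first exact: fin_numM.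
by rewrite lebesgue_measure_itv/=; case: ifPn.
Qed.

Lemma integrable_cube n C M :
  (lebesgue_rV n).-integrable setT (fun x => (M * \1_(cube C) x)%:E).
Proof.
have mC := @measurable_cube n C.
have : (lebesgue_rV n).-integrable setT (fun x => (\1_(@cube n C) x)%:E).
  apply/integrableP; split; first exact/measurable_EFinP/measurable_indic.
  under eq_integral do rewrite gee0_abs ?lee_fin//.
  by rewrite integral_indic// setIT lebesgue_cube_lty.
move=> /(integrableZl measurableT M); apply: eq_integrable => // x _.
Qed.

Lemma le_integrable_cube n (f : 'rV[R]_n -> R) C M : continuous f ->
  (forall x, `|f x| <= M * \1_(cube C) x) ->
  (lebesgue_rV n).-integrable setT (fun x => (f x)%:E).
Proof.
move=> cf fM; apply: le_integrable (integrable_cube n C M) => //.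
  by apply/measurable_EFinP; exact: continuous_measurable_rV cf.
by move=> x _; rewrite !abse_EFin lee_fin (le_trans (fM x))// ler_norm.
Qed.

(** The bound is stated with the indicator of a cube because cubes are
    star-shaped: it then also dominates the dilates x |-> f (t x) for t >= 1. *)
Lemma compact_support_le_cube n (f : 'rV[R]_n -> R) (S : set 'rV[R]_n) :
  continuous f -> compact S -> (forall x, ~ S x -> f x = 0) ->
  exists C M, 0 <= M /\ forall x, `|f x| <= M * \1_(cube C) x.
Proof.
move=> cf cS fS.
have [C SC] : exists C, forall x, S x -> `|x| <= C.
  have [C [_ /(_ (`|C| + 1))]] := compact_bounded cS.
  rewrite ltr_pwDr// ?ler_norm// => /(_ isT) SC.
  by exists (`|C| + 1).
have [M M0 fM] : exists2 M, 0 <= M & forall x, S x -> `|f x| <= M.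
  have [|M [_ /(_ (`|M| + 1))]] := @compact_bounded _ _ (f @` S).
    by apply: continuous_compact => //; exact: continuous_subspaceT.
  rewrite ltr_pwDr// ?ler_norm// => /(_ isT) SM.
  exists (`|M| + 1) => [|x Sx]; first by rewrite addr_ge0.
  by apply: SM; exists x.
exists C, M; split => // x.
have [Sx|/fS ->] := pselect (S x); last by rewrite normr0 mulr_ge0.
rewrite indicE mem_set ?mulr1; first exact: fM.
by move=> i; rewrite in_itv/= -ler_norml (le_trans (rV_coord_norm x i))// SC.
Qed.

Lemma compact_support_integrable n (f : 'rV[R]_n -> R) (S : set 'rV[R]_n) :
  continuous f -> compact S -> (forall x, ~ S x -> f x = 0) ->
  (lebesgue_rV n).-integrable setT (fun x => (f x)%:E).
Proof.
move=> cf cS fS; have [C [M [_ fM]]] := compact_support_le_cube cf cS fS.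
exact: le_integrable_cube fM.
Qed.

(** Off the closed set S the function is locally constant, so only the points of
    S matter. *)
Lemma continuous_closed_support (T : topologicalType) (f : T -> R) (S : set T) :
  closed S -> (forall x, ~ S x -> f x = 0) ->
  (forall x, S x -> {for x, continuous f}) -> continuous f.
Proof.
move=> cS f0 fS x; have [/fS//|Sx] := pselect (S x).
rewrite /continuous_at (f0 _ Sx); apply: cvg_near_cst.
have : nbhs x (~` S) by apply: open_nbhs_nbhs; split => //; exact: closed_openC.
by apply: filterS => y /f0.
Qed.

End borel_rV.

(** * Sublinear functions and their subgradients *)

Section sublinear.
Context {R : realType} {V : lmodType R}.
Implicit Types (q : V -> R) (x v e : V).

Definition sublinear q :=
  (forall x y, q (x + y) <= q x + q y) /\
  (forall t x, 0 <= t -> q (t *: x) = t * q x).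

Lemma sublinear0 q : sublinear q -> q 0 = 0.
Proof. by move=> [_ /(_ 0 0)]; rewrite scale0r mul0r; exact. Qed.

Lemma sublinearN q x : sublinear q -> - q (- x) <= q x.
Proof.
move=> sq; have [+ _] := sq => /(_ x (- x)).
by rewrite subrr sublinear0// -subr_ge0; lra.
Qed.

(** With t = 1/h the quantity under the infimum is (q (e + h v) - q e) / h, which
    decreases as h decreases to 0: this is the one-sided directional derivative
    of q at e along v. As a function of v it is a sublinear minorant of q that is
    linear along the line through e; taking the infimum over t avoids limits. *)
Definition right_slope q e v : R :=
  inf [set q (v + t *: e) - t * q e | t in [set t | 0 <= t]].

Section right_slope.
Variables (q : V -> R) (e : V).
Hypothesis sq : sublinear q.

Lemma has_inf_right_slope v :
  has_inf [set q (v + t *: e) - t * q e | t in [set t | 0 <= t]].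
Proof.
split; first by exists (q (v + 0 *: e) - 0 * q e); exists 0 => /=.
exists (- q (- v)) => _ [t /= t0 <-].
have [sub hom] := sq; have := sub (v + t *: e) (- v).
by rewrite addrC addKr hom// => ?; lra.
Qed.

Lemma right_slope_ub v t : 0 <= t -> right_slope q e v <= q (v + t *: e) - t * q e.
Proof. by move=> t0; apply: ge_inf; [case: (has_inf_right_slope v)|exists t]. Qed.

Lemma right_slope_le v : right_slope q e v <= q v.
Proof. by have := right_slope_ub v (lexx 0); rewrite scale0r addr0 mul0r subr0. Qed.

Lemma right_slope_adherent v (eps : R) : 0 < eps ->
  exists2 t, 0 <= t & q (v + t *: e) - t * q e < right_slope q e v + eps.
Proof.
by move=> e0; have [_ [t /= t0 <-] lt] := inf_adherent e0 (has_inf_right_slope v); exists t.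
Qed.

Lemma sublinear_right_slope : sublinear (right_slope q e).
Proof.
have [sub hom] := sq; split=> [v w|t v].
  apply/ler_addgt0Pr => eps e0; have e20 : 0 < eps / 2 by rewrite divr_gt0.
  have [s s0 sv] := right_slope_adherent v e20.
  have [t t0 tw] := right_slope_adherent w e20.
  have := right_slope_ub (v + w) (addr_ge0 s0 t0).
  have := sub (v + s *: e) (w + t *: e).
  by rewrite addrACA -scalerDl => ? ?; lra.
rewrite le_eqVlt => /predU1P[<-|t0].
  rewrite scale0r mul0r; apply/eqP; rewrite eq_le; apply/andP; split.
    by rewrite -(sublinear0 sq) right_slope_le.
  apply: lb_le_inf; first by case: (has_inf_right_slope 0).
  by move=> _ [r /= r0 <-]; rewrite add0r hom// subrr.
suff scale_le (s : R) w : 0 < s -> right_slope q e (s *: w) <= s * right_slope q e w.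
  apply/eqP; rewrite eq_le scale_le//=.
  have := scale_le t^-1 (t *: v); rewrite invr_gt0 scalerA mulVf ?gt_eqF// scale1r.
  by move=> /(_ t0); rewrite ler_pdivlMl.
move=> s0; rewrite -ler_pdivrMl//; apply: lb_le_inf.
  by case: (has_inf_right_slope w).
move=> _ [r /= r0 <-]; rewrite ler_pdivrMl//.
have := right_slope_ub (s *: w) (mulr_ge0 (ltW s0) r0).
by rewrite -scalerA -scalerDr (hom _ _ (ltW s0)) mulrBr mulrA.
Qed.

Lemma right_slope_opp : right_slope q e (- e) = - q e.
Proof.
have := @right_slope_ub (- e) 1; rewrite scale1r addNr sublinear0// mul1r sub0r => /(_ ler01).
have := sublinearN e sublinear_right_slope.
have := right_slope_le e => ? ? ?; lra.
Qed.

Lemma right_slope_id : right_slope q e e = q e.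
Proof.
have := sublinearN e sublinear_right_slope; rewrite right_slope_opp opprK.
have := right_slope_le e => ? ?; lra.
Qed.

End right_slope.

(** Linearity along a line is inherited by smaller sublinear functions, which is
    why the slopes along several vectors can be taken one after the other. *)
Lemma sublinear_le_linear q q' e : sublinear q' -> (forall v, q' v <= q v) ->
  q (- e) = - q e -> q' e = q e /\ q' (- e) = - q' e.
Proof.
move=> sq' le qe.
have := sublinearN e sq'; have := le e; have := le (- e); rewrite qe => ? ? ?.
by split; lra.
Qed.

Lemma sublinear_linear_on_seq q (s : seq V) : sublinear q ->
  exists q', [/\ sublinear q', forall v, q' v <= q v &
    {in s, forall e, q' (- e) = - q' e}].
Proof.
move=> sq; elim: s => [|e s [q1 [sq1 leq1 lin1]]]; first by exists q; split.
have sq2 := sublinear_right_slope e sq1; exists (right_slope q1 e); split => //.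
  by move=> v; exact: le_trans (right_slope_le e sq1 v) (leq1 v).
move=> x; rewrite inE => /predU1P[->|xs]; first by rewrite right_slope_opp// right_slope_id.
by have [] := sublinear_le_linear sq2 (right_slope_le e sq1) (lin1 _ xs).
Qed.

End sublinear.

Section linear_minorant.
Context {R : realType} {N : nat}.
Implicit Types (q : 'rV[R]_N -> R) (x v e p : 'rV[R]_N).

Lemma dotvC x y : dotv x y = dotv y x.
Proof. by apply: eq_bigr => i _; rewrite mulrC. Qed.

Lemma dotvDr p x y : dotv p (x + y) = dotv p x + dotv p y.
Proof. by rewrite /dotv -big_split/=; apply: eq_bigr => i _; rewrite mxE mulrDr. Qed.

Lemma dotvZr p a x : dotv p (a *: x) = a * dotv p x.
Proof. by rewrite /dotv mulr_sumr; apply: eq_bigr => i _; rewrite mxE mulrCA. Qed.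

Lemma dotvNr p x : dotv p (- x) = - dotv p x.
Proof. by rewrite -scaleN1r dotvZr mulN1r. Qed.

Lemma dotvZl p a x : dotv (a *: x) p = a * dotv x p.
Proof. by rewrite dotvC dotvZr dotvC. Qed.

Lemma dotv_basis p i : dotv p (basis_vec i) = p ord0 i.
Proof.
rewrite /dotv (bigD1 i)//= big1 ?addr0 => [|j ji]; rewrite mxE eqxx/= ?eqxx ?mulr1//.
by rewrite (negbTE ji) mulr0.
Qed.

Lemma dotv_gt0 p : p != 0 -> 0 < dotv p p.
Proof.
move=> p0; rewrite lt_def; apply/andP; split; last first.
  by apply: sumr_ge0 => i _; rewrite -expr2 sqr_ge0.
apply: contra p0 => /eqP /psumr_eq0P pp; apply/eqP/rowP => i; rewrite mxE.
apply/eqP; rewrite -[_ == _]orbb -mulf_eq0 pp// => j _.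
by rewrite -expr2 sqr_ge0.
Qed.

Lemma rV_sum_basis x : x = \sum_i x ord0 i *: basis_vec i.
Proof. exact: row_sum_delta. Qed.

Lemma sublinear_sum q (I : Type) (r : seq I) (F : I -> 'rV[R]_N) : sublinear q ->
  q (\sum_(i <- r) F i) <= \sum_(i <- r) q (F i).
Proof.
move=> sq; elim/big_ind2 : _ => //[|x1 y1 x2 y2 h1 h2]; first by rewrite sublinear0.
by have [sub _] := sq; rewrite (le_trans (sub _ _))// lerD.
Qed.

Lemma sublinear_linear q : sublinear q ->
  (forall i, q (- basis_vec i) = - q (basis_vec i)) ->
  forall v, q v = dotv (\row_i q (basis_vec i)) v.
Proof.
move=> sq lin.
have le v : q v <= dotv (\row_i q (basis_vec i)) v.
  rewrite [in leLHS](rV_sum_basis v) (le_trans (sublinear_sum _ _ _))//.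
  apply: ler_sum => i _; rewrite mxE mulrC.
  have [_ hom] := sq; have [v0|v0] := leP 0 (v ord0 i); first by rewrite hom.
  rewrite -[v ord0 i]opprK scaleNr -scalerN hom ?lin ?mulrN ?mulNr//.
  by rewrite oppr_ge0 ltW.
move=> v; apply/eqP; rewrite eq_le le/=.
by have := le (- v); have := sublinearN v sq; rewrite dotvNr => ? ?; lra.
Qed.

(** Finite-dimensional Hahn-Banach theorem: taking slopes along e and then along
    the vectors of the canonical basis makes q linear without changing its value
    at e. *)
Lemma sublinear_subgradient q e : sublinear q ->
  exists p, (forall v, dotv p v <= q v) /\ dotv p e = q e.
Proof.
move=> sq; have sq1 := sublinear_right_slope e sq.
have [q2 [sq2 le2 lin2]] := sublinear_linear_on_seq (codom basis_vec) sq1.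
have {}lin2 i : q2 (- basis_vec i) = - q2 (basis_vec i).
  by apply: lin2; exact: codom_f.
exists (\row_i q2 (basis_vec i)); split => [v|]; rewrite -sublinear_linear//.
  exact: le_trans (le2 v) (right_slope_le e sq v).
have [|-> _] := @sublinear_le_linear _ _ (right_slope q e) q2 e sq2 le2.
  by rewrite right_slope_opp// right_slope_id.
by rewrite right_slope_id.
Qed.

(** The difference quotients for h > 0 tend to the slope along v, those for h < 0
    to the opposite of the slope along - v. *)
Lemma sublinear_is_derive q x v (D : R) : sublinear q ->
  right_slope q x v = D -> right_slope q x (- v) = - D ->
  is_derive x v q D.
Proof.
move=> sq qv qNv; have [sub hom] := sq.
have slope w (t : R) : 0 < t ->
    q (w + t^-1 *: x) - t^-1 * q x = t^-1 * (q (t *: w + x) - q x).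
  move=> t0; rewrite mulrBr; congr (_ - _).
  rewrite -hom ?invr_ge0 ?ltW// scalerDr scalerA mulVf ?gt_eqF//.
  by rewrite scale1r.
have near_slope w (eps : R) : 0 < eps ->
    exists2 d, 0 < d & forall t, 0 < t -> t < d ->
      right_slope q x w <= t^-1 * (q (t *: w + x) - q x) < right_slope q x w + eps.
  move=> e0; have [s s0 sw] := right_slope_adherent x sq w e0.
  have s10 : 0 < s + 1 by rewrite ltr_pwDr.
  exists (s + 1)^-1; rewrite ?invr_gt0// => t t0 ts.
  have {}ts : s < t^-1.
    by rewrite (@lt_trans _ _ (s + 1)) ?ltrDl// -[ltLHS]invrK ltf_pV2 ?posrE ?invr_gt0.
  rewrite -slope// right_slope_ub ?invr_ge0 ?ltW//=.
  apply: le_lt_trans sw.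
  have := sub (w + s *: x) ((t^-1 - s) *: x).
  rewrite -addrA -scalerDl [s + _]addrC subrK hom; first by move=> ?; lra.
  by rewrite subr_ge0 ltW.
suff cvgD : (fun h => h^-1 *: ((q \o shift x) (h *: v) - q x)) @ 0^' --> D.
  by apply: DeriveDef; [apply/cvg_ex; exists D|exact: cvg_lim].
apply/cvgrPdist_lt => eps e0.
have [d d0 dv] := near_slope v _ e0; have [d' d'0 dNv] := near_slope (- v) _ e0.
rewrite qv in dv; rewrite qNv in dNv.
have dd : 0 < Num.min d d' by rewrite lt_min d0.
near=> h.
have hd : `|h| < Num.min d d' by near: h; exact: dnbhs0_lt.
have h0 : h != 0 by near: h; exact: nbhs_dnbhs_neq.
move: hd; rewrite lt_min => /andP[hd hd'].
case: (ltgtP h 0) h0 => // hs _.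
  rewrite ltr0_norm// in hd'.
  have := dNv (- h); rewrite oppr_gt0 => /(_ hs hd').
  rewrite invrN scalerN scaleNr opprK mulNr /= => /andP[l1 l2].
  by rewrite ltr_norml /GRing.scale/=; lra.
rewrite gtr0_norm// in hd.
have /andP[l1 l2] := dv h hs hd.
by rewrite ltr_norml /GRing.scale/=; lra.
Unshelve. all: by end_near. Qed.

End linear_minorant.

(** * The gauge of a convex body *)

Section gauge.
Context {R : realType} {N : nat}.
Variable K : set 'rV[R]_N.
Hypothesis K_body : convex_body K.
Hypothesis K_o : interior K 0.
Implicit Types (x y v p : 'rV[R]_N).
Local Notation g := (minkowski_functional K).
Local Notation E x := [set l : R | 0 <= l /\ [set l *: y | y in K] x].

Lemma body_origin : K 0.
Proof. exact: interior_subset K_o. Qed.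

Lemma body_conv x y (t : R) : K x -> K y -> 0 <= t -> t <= 1 ->
  K (t *: x + (1 - t) *: y).
Proof.
case: K_body => cK _ _ Kx Ky t0 t1.
have := cK x y (Itv01 t0 t1); rewrite !inE => /(_ Kx Ky); exact.
Qed.

Lemma body_shrink x (t : R) : K x -> 0 <= t -> t <= 1 -> K (t *: x).
Proof.
by move=> Kx t0 t1; have := body_conv Kx body_origin t0 t1; rewrite scaler0 addr0.
Qed.

Lemma body_ball_sub : exists2 r : R, 0 < r & forall y, `|y| < r -> K y.
Proof.
have /nbhs_normP[r r0 rK] : nbhs (0 : 'rV[R]_N) K by exact: K_o.
by exists r => // y yr; apply: rK; rewrite /= sub0r normrN.
Qed.

Lemma gauge_has_inf x : has_inf (E x).
Proof.
split; last by exists 0 => l [].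
have [r r0 rK] := body_ball_sub.
have l0 : 0 < (`|x| + 1) / r by rewrite divr_gt0// ltr_wpDl.
exists ((`|x| + 1) / r); split; first exact: ltW.
exists (((`|x| + 1) / r)^-1 *: x); last by rewrite scalerA divff ?scale1r// gt_eqF.
apply: rK; rewrite normrZ gtr0_norm ?invr_gt0// invf_div mulrAC ltr_pdivrMr ?ltr_wpDl//.
by rewrite ltr_pM2l// ltrDl.
Qed.

Lemma gauge_ge0 x : 0 <= g x.
Proof. by apply: lb_le_inf; [case: (gauge_has_inf x)|move=> l []]. Qed.

Lemma gauge_le (l : R) y : 0 <= l -> K y -> g (l *: y) <= l.
Proof.
by move=> l0 Ky; apply: ge_inf; [case: (gauge_has_inf (l *: y))|split => //; exists y].
Qed.

Lemma gauge_adherent x (e : R) : 0 < e ->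
  exists2 l : R, 0 <= l < g x + e & exists2 y, K y & l *: y = x.
Proof.
by move=> e0; have [l [l0 xl] lt] := inf_adherent e0 (gauge_has_inf x); exists l; rewrite ?l0.
Qed.

Lemma gauge_sublinear : sublinear g.
Proof.
have scale_le (t : R) x : 0 <= t -> g (t *: x) <= t * g x.
  rewrite le_eqVlt => /predU1P[<-|t0].
    by rewrite scale0r mul0r -[X in g X](scale0r 0) gauge_le//; exact: body_origin.
  apply/ler_addgt0Pr => e e0; have [l /andP[l0 lt] [y Ky xE]] := gauge_adherent x (divr_gt0 e0 t0).
  rewrite -{1}xE scalerA (le_trans (gauge_le _ _))//; first by rewrite mulr_ge0// ltW.
  rewrite -ler_pdivlMl// mulrDr mulKf ?gt_eqF// [t^-1 * e]mulrC.
  exact: ltW.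
split=> [x y|t x]; last first.
  rewrite le_eqVlt => /predU1P[<-|t0].
    by apply/eqP; rewrite eq_le scale_le//= mul0r gauge_ge0.
  apply/eqP; rewrite eq_le (scale_le _ _ (ltW t0))/=.
  have := scale_le t^-1 (t *: x); rewrite invr_ge0 scalerA mulVf ?gt_eqF// scale1r.
  by rewrite ler_pdivlMl//; apply; exact: ltW.
apply/ler_addgt0Pr => e e0; have e20 : 0 < e / 2 by rewrite divr_gt0.
have [l /andP[l0 ll] [a Ka xE]] := gauge_adherent x e20.
have [m /andP[m0 mm] [b Kb yE]] := gauge_adherent y e20.
have lm0 : 0 <= l + m by rewrite addr_ge0.
suff : g (l *: a + m *: b) <= l + m by rewrite xE yE; move: ll mm; lra.
have [lm|lm] := eqVneq (l + m) 0.
  have [-> ->] : l = 0 /\ m = 0 by split; lra.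
  by rewrite !scale0r !addr0 -[X in g X](scale0r 0) gauge_le//; exact: body_origin.
have lm1 : 0 < l + m by rewrite lt_def lm.
have -> : l *: a + m *: b = (l + m) *: ((l / (l + m)) *: a + (1 - l / (l + m)) *: b).
  rewrite scalerDr !scalerA; congr (_ *: _ + _ *: _); field; exact: lm.
apply: gauge_le => //; apply: body_conv => //; first by rewrite divr_ge0.
by rewrite ler_pdivrMr// mul1r lerDl.
Qed.

Lemma gaugeZ (t : R) x : 0 <= t -> g (t *: x) = t * g x.
Proof. by have [_] := gauge_sublinear; exact. Qed.

Lemma gauge_lt1 x : g x < 1 -> K x.
Proof.
move=> gx; have [|l /andP[l0]] := @gauge_adherent x (1 - g x); first by rewrite subr_gt0.
by rewrite addrC subrK => l1 [y Ky <-]; apply: body_shrink => //; exact: ltW.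
Qed.

Lemma gauge_le1 x : K x -> g x <= 1.
Proof. by move=> Kx; rewrite -[x]scale1r gauge_le. Qed.

Lemma gauge_gt0 x : x != 0 -> 0 < g x.
Proof.
move=> x0.
have [C C0 KC] : exists2 C, 0 < C & forall y, K y -> `|y| <= C.
  have [_ cK _] := K_body; have [C [_ /(_ (`|C| + 1))]] := compact_bounded cK.
  rewrite ltr_pwDr// ?ler_norm// => /(_ isT) SC.
  by exists (`|C| + 1) => //; rewrite ltr_pwDr.
suff : `|x| / C <= g x by apply: lt_le_trans; rewrite divr_gt0// normr_gt0.
apply: lb_le_inf; first by case: (gauge_has_inf x).
move=> l [l0 [y Ky <-]]; rewrite normrZ ger0_norm// ler_pdivrMr//.
by rewrite ler_wpM2l// KC.
Qed.

Lemma gauge_continuous : continuous g.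
Proof.
have [r r0 rK] := body_ball_sub.
have gle y : g y <= `|y| / r.
  apply/ler_addgt0Pr => e e0; rewrite -[y in g y]scale1r.
  have re : 0 < `|y| / r + e by rewrite ltr_wpDl// divr_ge0// ltW.
  rewrite -[1](@mulfV _ (`|y| / r + e)) ?gt_eqF// -scalerA.
  apply: gauge_le; first exact: ltW.
  apply: rK; rewrite normrZ gtr0_norm ?invr_gt0// mulrC ltr_pdivrMr//.
  by rewrite mulrDr mulrCA divff ?gt_eqF// mulr1 ltrDl mulr_gt0.
have [sub _] := gauge_sublinear.
move=> x; apply/(@cvgrPdist_lt _ _ _ _ (nbhs_filter x)) => e e0.
apply: (@nbhs_normP R 'rV[R]_N x _).2 => /=.
exists (e * r) => [|y /= xy]; first exact: mulr_gt0.
have yx : `|y - x| < e * r by rewrite distrC.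
move: xy yx; rewrite -!ltr_pdivrMr// => xy yx.
rewrite ltr_norml.
have := sub (x - y) y; have := sub (y - x) x; rewrite !subrK.
by have := gle (x - y); have := gle (y - x) => ? ? ? ?; lra.
Qed.

(** For the interior: a neighbourhood of x in K contains (1 + t) x for small
    t > 0, where the gauge is larger than 1. *)
Lemma gauge1_boundary x : g x = 1 -> boundary K x.
Proof.
move=> gx; split.
  rewrite closureE => B [cB KB].
  have [//|nBx] := pselect (B x); exfalso.
  have /nbhs_normP[e /= e0 eB] : nbhs x (~` B).
    by apply: open_nbhs_nbhs; split => //; exact: closed_openC.
  pose t := Num.min (1/2) (e / (2 * (`|x| + 1))).
  have x1 : 0 < `|x| + 1 by rewrite ltr_wpDl.
  have t0 : 0 < t by rewrite lt_min divr_gt0//= divr_gt0// mulr_gt0.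
  have t1 : t <= 1/2 by rewrite ge_min lexx.
  have te : t * (2 * (`|x| + 1)) <= e by rewrite -ler_pdivlMr ?mulr_gt0// ge_min lexx orbT.
  apply: (eB ((1 - t) *: x)).
    rewrite /= scalerBl scale1r opprB addrC subrK normrZ gtr0_norm//.
    apply: lt_le_trans te; rewrite ltr_pM2l//.
    by have := normr_ge0 x => ?; lra.
  apply/KB/gauge_lt1; rewrite gaugeZ ?gx ?mulr1; lra.
move=> /nbhs_normP[e /= e0 eK].
have x1 : 0 < `|x| + 1 by rewrite ltr_wpDl.
pose t := e / (`|x| + 1).
have t0 : 0 < t by rewrite divr_gt0.
have : K ((1 + t) *: x).
  apply: eK; rewrite /= scalerDl scale1r opprD addrA subrr sub0r normrN normrZ.
  rewrite gtr0_norm// mulrAC ltr_pdivrMr// ltr_pM2l//.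
  by rewrite ltrDl.
move=> /gauge_le1; rewrite gaugeZ ?gx ?mulr1; last by rewrite addr_ge0// ltW.
by rewrite gerDl leNgt t0.
Qed.

Hypothesis K_smooth : smooth_body K.

(** A subgradient p of g at x supports K at x / g(x), so p / |p| is the outer unit
    normal there; the length of p is then fixed by p . x = g(x). *)
Lemma gauge_subgradient_unique x p p' : x != 0 ->
  (forall v, dotv p v <= g v) -> dotv p x = g x ->
  (forall v, dotv p' v <= g v) -> dotv p' x = g x -> p = p'.
Proof.
move=> x0 pg px p'g p'x; have gx := gauge_gt0 x0.
have norm_gt0 a : dotv a x = g x -> 0 < Num.sqrt (dotv a a).
  move=> ax; rewrite sqrtr_gt0 dotv_gt0//; apply: contra_eq_neq ax => ->.
  by rewrite /dotv big1 ?lt_eqF// => i _; rewrite mxE mul0r.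
have normal a : (forall v, dotv a v <= g v) -> dotv a x = g x ->
    outer_unit_normal K ((g x)^-1 *: x) ((Num.sqrt (dotv a a))^-1 *: a).
  move=> ag ax; have a0 := norm_gt0 a ax; split.
    rewrite dotvZl dotvZr -[X in _ * (_ * X)]sqr_sqrtr.
      by field; rewrite gt_eqF.
    by rewrite ltW// -sqrtr_gt0.
  move=> y Ky; rewrite dotvZr pmulr_rle0 ?invr_gt0//.
  rewrite dotvC dotvDr dotvNr dotvZr ax mulVf ?gt_eqF//.
  by rewrite subr_le0 (le_trans (ag y))// gauge_le1.
have [|nu [_ nuP]] := K_smooth (x := (g x)^-1 *: x).
  by apply: gauge1_boundary; rewrite gaugeZ ?invr_ge0 ?ltW// mulVf// gt_eqF.
have e : (Num.sqrt (dotv p p))^-1 *: p = (Num.sqrt (dotv p' p'))^-1 *: p'.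
  by rewrite -(nuP _ (normal p pg px)) -(nuP _ (normal p' p'g p'x)).
have n : (Num.sqrt (dotv p p))^-1 = (Num.sqrt (dotv p' p'))^-1.
  have := congr1 (dotv^~ x) e; rewrite /= !dotvZl px p'x.
  by apply: mulIf; rewrite gt_eqF.
by move: e; rewrite n; apply: scalerI; rewrite gt_eqF// invr_gt0 norm_gt0.
Qed.

(** Any p below the slope function of g at x is a subgradient at x with
    p . x = g(x). By Hahn-Banach such a p can be chosen to agree with the slope
    along any prescribed v; as p is unique, the slope is linear, hence two-sided.
    The relation p . x = g(x) is Euler's identity for g. *)
Lemma gauge_is_derive x : x != 0 ->
  exists2 p, dotv p x = g x & forall v, is_derive x v g (dotv p v).
Proof.
move=> x0; have sg := gauge_sublinear; have sl := sublinear_right_slope x sg.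
have touch p : (forall v, dotv p v <= right_slope g x v) ->
    (forall v, dotv p v <= g v) /\ dotv p x = g x.
  move=> pl; split=> [v|]; first exact: le_trans (pl v) (right_slope_le x sg v).
  have := pl x; have := pl (- x); rewrite dotvNr right_slope_opp// right_slope_id// => ? ?.
  by lra.
have [p [pl _]] := sublinear_subgradient 0 sl.
have [pg px] := touch p pl.
have slope v : right_slope g x v = dotv p v.
  have [p' [p'l <-]] := sublinear_subgradient v sl.
  have [p'g p'x] := touch p' p'l.
  by rewrite (gauge_subgradient_unique x0 p'g p'x pg px).
exists p => // v; apply: sublinear_is_derive => //.
by rewrite slope dotvNr.
Qed.

End gauge.

(** * Directional derivatives *)

Section continuity.
Context {R : realType} {T : topologicalType}.
Implicit Types (f g : T -> R) (x : T).

(** Continuity at a point for functions given by a formula in y, a shape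
    that does not unify with the sum f + g or the product f * g of functions. *)
Lemma continuous_for_cst (c : R) x : {for x, continuous (fun _ : T => c)}.
Proof. exact: cst_continuous. Qed.

Lemma continuous_forM f g x : {for x, continuous f} -> {for x, continuous g} ->
  {for x, continuous (fun y => f y * g y)}.
Proof. exact: continuousM. Qed.

Lemma continuous_forD f g x : {for x, continuous f} -> {for x, continuous g} ->
  {for x, continuous (fun y => f y + g y)}.
Proof. exact: continuousD. Qed.

Lemma continuous_forB f g x : {for x, continuous f} -> {for x, continuous g} ->
  {for x, continuous (fun y => f y - g y)}.
Proof. exact: continuousB. Qed.

End continuity.
Arguments continuous_for_cst {R T} c x.

Section directional.
Context {R : realType} {V : normedModType R}.
Implicit Types (f g : V -> R) (x y v e : V).

Lemma is_derive_line f y e (s d : R) :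
  is_derive (y + s *: e) e f d <-> is_derive s 1 (fun t : R => f (y + t *: e)) d.
Proof.
have eqq : (fun h : R => h^-1 *: ((f \o shift (y + s *: e)) (h *: e) - f (y + s *: e))) =
   (fun h : R => h^-1 *: (((fun t : R => f (y + t *: e)) \o shift s) (h *: 1) -
      f (y + s *: e))).
  apply/funext => h /=; congr (_ *: (f _ - _)).
  by rewrite [h *: 1]mulr1 scalerDl addrCA.
by split=> -[ex val]; split; move: ex val; rewrite /derivable /derive eqq.
Qed.

Lemma is_derive_line0 f y e (d : R) :
  is_derive y e f d <-> is_derive (0 : R) 1 (fun t : R => f (y + t *: e)) d.
Proof. by rewrite -is_derive_line scale0r addr0. Qed.

Lemma is_derive_scale_direction f y e (c d : R) :
  is_derive y e f d -> is_derive y (c *: e) f (c * d).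
Proof.
rewrite !is_derive_line0 => fd.
have -> : (fun t : R => f (y + t *: (c *: e))) =
    (fun t : R => f (y + t *: e)) \o ( *%R^~ c).
  by apply/funext => t /=; rewrite scalerA.
rewrite mulrC; apply: is_derive1_comp; first by rewrite mul0r.
have -> : *%R^~ c = (c *: (@id R)) by apply/funext => t; rewrite /= mulrC.
have := is_deriveZ c (is_derive_id (0 : R) 1).
by rewrite /GRing.scale/= mulr1.
Qed.

Lemma is_derive_comp g (phi : R -> R) x v (dg dphi : R) :
  is_derive x v g dg -> is_derive (g x) 1 phi dphi ->
  is_derive x v (phi \o g) (dphi * dg).
Proof.
rewrite !is_derive_line0 => dvg dvphi.
apply: (@is_derive1_comp _ phi (fun t : R => g (x + t *: v))) => //.
by rewrite scale0r addr0.
Qed.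

Lemma is_derive_continuous (phi : R -> R) (r d : R) :
  is_derive r 1 phi d -> {for r, continuous phi}.
Proof.
by case=> ex _; apply/differentiable_continuous/derivable1_diffP.
Qed.

Lemma mean_value_line f y e (t : R) : (forall z, derivable f z e) ->
  exists2 s : R, `|s| <= `|t| & f (y + t *: e) - f y = t * 'D_e f (y + s *: e).
Proof.
move=> df; pose F (s : R) := f (y + s *: e).
have dF (s : R) : is_derive s 1 F ('D_e f (y + s *: e)).
  by apply/is_derive_line; exact: derivableP.
have cF (a b : R) : {within `[a, b], continuous F}.
  apply: continuous_subspaceT => s; exact: is_derive_continuous (dF s).
have [t0|t0] := leP 0 t.
  have [s /[!in_itv]/= /andP[s0 st]] := MVT_segment t0 (fun s _ => dF s) (cF 0 t).
  rewrite subr0 /F scale0r addr0 mulrC => ->.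
  by exists s => //; rewrite !ger0_norm.
have [s /[!in_itv]/= /andP[ts s0]] := MVT_segment (ltW t0) (fun s _ => dF s) (cF t 0).
rewrite sub0r /F scale0r addr0 mulrN mulrC => Fts.
exists s; first by rewrite !ler0_norm ?lerN2// ltW.
by move: Fts => /eqP; rewrite subr_eq => /eqP ->; rewrite opprD addrCA subrr addr0 opprK.
Qed.

(** The increment of f along h (v + c e) splits into the one along h v and the one
    from there along h c e; the mean value theorem writes the latter as
    h c 'D_e f at a point close to x, where 'D_e f is close to its value at x. *)
Lemma is_deriveD_direction f x v e (c d : R) : is_derive x v f d ->
  (forall z, derivable f z e) -> {for x, continuous ('D_e f)} ->
  is_derive x (v + c *: e) f (d + c * 'D_e f x).
Proof.
move=> [dv vald] de ce.
have cvg1 : (fun h : R => h^-1 *: ((f \o shift x) (h *: v) - f x)) @ 0^' --> d.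
  by rewrite -vald; exact: dv.
have cvg2 : (fun h : R => h^-1 *: ((f \o shift x) (h *: (v + c *: e)) -
     (f \o shift x) (h *: v))) @ 0^' --> c * 'D_e f x.
  apply/cvgrPdist_le => eps e0.
  have c1 : 0 < `|c| + 1 by rewrite ltr_wpDl.
  have e1 : 0 < eps / (`|c| + 1) by rewrite divr_gt0.
  have /cvgrPdist_le/(_ _ e1)/nbhs_normP[del /= del0 delP] := ce.
  pose M := `|v| + `|c| * `|e| + 1.
  have M0 : 0 < M by rewrite ltr_wpDl// addr_ge0// mulr_ge0.
  have dM0 : 0 < del / M by rewrite divr_gt0.
  near=> h.
  have h0 : h != 0 by near: h; exact: nbhs_dnbhs_neq.
  have hd : `|h| < del / M by near: h; exact: dnbhs0_lt.
  have [s ss] := @mean_value_line f (h *: v + x) e (h * c) de.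
  rewrite /= [h *: (v + _)]scalerDr scalerA [h *: v + _ + x]addrAC => ->.
  rewrite /GRing.scale/= -mulrA mulKf// -mulrBr normrM.
  have : `|'D_e f x - 'D_e f (h *: v + x + s *: e)| <= eps / (`|c| + 1).
    apply: delP; rewrite /= addrAC opprD addrCA subrr addr0 normrN.
    rewrite (le_lt_trans (ler_normD _ _))// !normrZ.
    apply: (@le_lt_trans _ _ (`|h| * (`|v| + `|c| * `|e|))).
      by rewrite mulrDr lerD2l mulrA -normrM ler_wpM2r.
    move: hd; rewrite ltr_pdivlMr//; apply: le_lt_trans.
    by rewrite ler_wpM2l// lerDl.
  rewrite ler_pdivlMr// mulrC; apply: le_trans.
  by rewrite ler_wpM2r// lerDl.
suff cvgD : (fun h : R => h^-1 *: ((f \o shift x) (h *: (v + c *: e)) - f x)) @ 0^'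
    --> d + c * 'D_e f x.
  by apply: DeriveDef; [apply/cvg_ex; eexists; exact: cvgD|exact: cvg_lim].
apply: cvg_trans (cvgD cvg1 cvg2); apply: near_eq_cvg; near=> h.
by rewrite fctE /= -scalerDr addrC addrA subrK.
Unshelve. all: by end_near. Qed.

End directional.

(** Continuous partial derivatives suffice because the coordinates of v can be
    added one at a time, each time by [is_deriveD_direction]. *)
Lemma class_C1_is_derive (R : realType) (N : nat) (u : 'rV[R]_N -> R) x v :
  class_Ck 1 u -> is_derive x v u (dotv (gradient u x) v).
Proof.
move=> [_ [du cu]].
have dpartial z i : derivable u z (basis_vec i) by exact: du.
have cpartial i : continuous ('D_(basis_vec i) u) by case: (cu i).
rewrite [v in is_derive _ v](rV_sum_basis v) /dotv.
elim: (index_enum 'I_N) => [|i s IH].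
  by rewrite !big_nil; exact: is_derive0.
rewrite !big_cons addrC [X in is_derive _ _ _ X]addrC mxE [partial _ _ _ * _]mulrC.
exact: (is_deriveD_direction _ IH (fun z => dpartial z i) (cpartial i x)).
Qed.

(** * The integral of the derivative along dilations *)

Section dilation.
Context {R : realType} {N : nat}.
Variables (f F : 'rV[R]_N -> R) (S : set 'rV[R]_N).
Hypotheses (cS : compact S) (f0 : forall x, ~ S x -> f x = 0)
  (F0 : forall x, ~ S x -> F x = 0).
Hypotheses (cf : continuous f) (cF : continuous F).
Hypothesis df : forall x, is_derive x x f (F x).

Let G x := N%:R * f x + F x.

Let h x (t : R) := t ^+ N * f (t *: x).

(** The factor t ^+ N * t^-1 stands for t ^+ N.-1, which would be wrong for
    N = 0. *)
Lemma is_derive_dilation x (t : R) : 0 < t ->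
  is_derive t 1 (h x) (t ^+ N * t^-1 * G (t *: x)).
Proof.
move=> t0.
have tx : t^-1 *: (t *: x) = x by rewrite scalerA mulVf ?scale1r// gt_eqF.
have dx : is_derive (t *: x) x f (t^-1 * F (t *: x)).
  have := is_derive_scale_direction t^-1 (df (t *: x)).
  rewrite tx; exact.
have dft : is_derive t 1 (fun s : R => f (s *: x)) (t^-1 * F (t *: x)).
  have -> : (fun s : R => f (s *: x)) = (fun s : R => f (0 + s *: x)).
    by apply/funext => s; rewrite add0r.
  have := (is_derive_line f 0 x t (t^-1 * F (t *: x))).1.
  by rewrite (add0r (t *: x)); apply.
have dX := is_deriveX N (is_derive_id t 1).
have -> : h x = (@id R) ^+ N * (fun s : R => f (s *: x)).
  by apply/funext => s; rewrite fctE exprfctE.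
suff <- : (@id R ^+ N) t *: (t^-1 * F (t *: x)) +
    f (t *: x) *: ((N%:R * t ^+ N.-1) *: 1) = t ^+ N * t^-1 * G (t *: x).
  exact: is_deriveM.
rewrite /GRing.scale/= exprfctE mulr1 /G.
move: (f (t *: x)) (F (t *: x)) => a b.
case: (N) => [|n]/=; first by rewrite !mul0r !expr0; ring.
by rewrite exprS; field; rewrite gt_eqF.
Qed.

(** The difference quotients of t |-> t^N f(t x) at t = 1 have integral zero, are
    bounded by a multiple of the indicator of a cube by the mean value theorem,
    and converge to N f + F. *)
Lemma integral_dilation_derivative :
  (\int[lebesgue_rV N]_x (N%:R * f x + F x)%:E = 0)%E.
Proof.
have cG : continuous G.
  move=> x; have cNf := continuous_forM (continuous_for_cst (N%:R : R) x) (@cf x).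
  exact (continuous_forD cNf (@cF x)).
have G0 x : ~ S x -> G x = 0 by move=> Sx; rewrite /G f0// F0// mulr0 addr0.
have [C [M [M0 GM]]] := compact_support_le_cube cG cS G0.
have [C' [M' [M'0 fM]]] := compact_support_le_cube cf cS f0.
have cube_star c x (t : R) : 1 <= t ->
    \1_(@cube R N c) (t *: x) <= \1_(@cube R N c) x :> R.
  move=> t1; rewrite !indicE ler_nat; case: (boolP (t *: x \in _)) => //.
  rewrite inE => tx; rewrite mem_set// => i; have := tx i; rewrite mxE !in_itv/= -!ler_norml.
  apply: le_trans; rewrite normrM ger0_norm ?(le_trans ler01)//.
  by rewrite ler_peMl.
have intf (t : R) : 1 <= t -> (lebesgue_rV N).-integrable setT (fun x => (f (t *: x))%:E).
  move=> t1; apply: (@le_integrable_cube _ _ _ C' M').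
    move=> x; apply: continuous_comp (@cf _); exact: scaler_continuous.
  by move=> x; rewrite (le_trans (fM _))// ler_wpM2l// cube_star.
have intf1 : (lebesgue_rV N).-integrable setT (fun x => (f x)%:E).
  exact: (@le_integrable_cube _ _ _ C' M').
pose d (k : nat) : R := k.+1%:R^-1.
have d0 k : 0 < d k by rewrite invr_gt0.
have d1 k : d k <= 1 by rewrite invf_le1// ler1n.
pose q k x := (d k)^-1 * (h x (1 + d k) - h x 1).
have intq k : (\int[lebesgue_rV N]_x (q k x)%:E = 0)%E.
  have t0 : 0 < 1 + d k by rewrite addr_gt0.
  have t1 : 1 <= 1 + d k by rewrite lerDl ltW.
  under eq_integral do rewrite /q EFinM /h expr1n mul1r scale1r EFinB EFinM.
  have iX : (lebesgue_rV N).-integrable setT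
      (fun x => (((1 + d k) ^+ N)%:E * (f ((1 + d k) *: x))%:E)%E).
    exact: integrableZl (intf _ t1).
  rewrite integralZl//; last exact: integrableB.
  rewrite integralB// integralZl//; last exact: intf.
  rewrite (integral_dilation t0 intf1) subee ?mule0//.
  exact: integrable_fin_num.
(* On [1, 1 + d k], a subset of [1, 2], the derivative is t^N / t * G(t x). *)
have qbound k x : `|q k x| <= 2 ^+ N * M * \1_(@cube R N C) x.
  have [t /[!in_itv]/= /andP[t1 t2] ht] : exists2 t, t \in `[1, 1 + d k] &
      h x (1 + d k) - h x 1 = t ^+ N * t^-1 * G (t *: x) * (1 + d k - 1).
    apply: MVT_segment.
    - by rewrite lerDl ltW.
    - move=> t; rewrite in_itv/= => /andP[t1 _]; apply: is_derive_dilation.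
      exact: lt_trans t1.
    - apply: derivable_within_continuous => t; rewrite in_itv/= => /andP[t1 _].
      have [] := @is_derive_dilation x t _ => //.
      exact: lt_le_trans t1.
  have t0 : 0 < t by exact: lt_le_trans t1.
  rewrite /q ht addrAC subrr add0r mulrC mulfK ?gt_eqF//.
  rewrite normrM -mulrA ler_pM//; last exact: le_trans (GM _) (ler_wpM2l M0 (cube_star _ _ _ t1)).
  rewrite ger0_norm ?mulr_ge0 ?exprn_ge0 ?invr_ge0 ?(ltW t0)//.
  apply: (@le_trans _ _ (t ^+ N)).
    by rewrite ler_piMr ?exprn_ge0 ?(ltW t0)// invf_le1.
  rewrite lerXn2r ?nnegrE ?(ltW t0)// (le_trans t2)//.
  by have := d1 k => ?; lra.
have cq k : continuous (q k).
  move=> x; have ch (t : R) : {for x, continuous (fun y : 'rV[R]_N => h y t)}.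
    have ct : {for x, continuous (fun y : 'rV[R]_N => f (t *: y))}.
      apply: continuous_comp (@cf _); exact: scaler_continuous.
    exact (continuous_forM (continuous_for_cst (t ^+ N) x) ct).
  have cqk := continuous_forB (ch (1 + d k)) (ch 1).
  exact (continuous_forM (continuous_for_cst ((d k)^-1 : R) x) cqk).
have qG x : (q k x)%:E @[k --> \oo] --> (G x)%:E.
  apply: cvg_EFin; first exact: nearW.
  have [ex val] := is_derive_dilation x ltr01.
  rewrite expr1n invr1 !mul1r scale1r in val.
  have cvgq : (fun s : R => s^-1 *: ((h x \o shift 1) (s *: 1) - h x 1)) @ 0^' --> G x.
    by rewrite -val; exact: ex.
  have dk0 : d @ \oo --> 0^'.
    move=> A nA.
    have : \forall k \near \oo, (d k != 0 -> A (d k)) := @cvg_harmonic R _ nA.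
    by apply: filterS => k; apply; rewrite gt_eqF.
  have := cvg_comp _ _ dk0 cvgq; apply: cvg_trans; apply: near_eq_cvg.
  by near=> k; rewrite /q /= [d k *: 1]mulr1 [d k + 1]addrC.
have [_ _] := @dominated_convergence _ _ _ (lebesgue_rV N) setT measurableT
  (fun k x => (q k x)%:E) (fun x => (G x)%:E)
  (fun x => (2 ^+ N * M * \1_(@cube R N C) x)%:E)
  (fun k => ((@measurable_EFinP _ _ _ _ _).2 (continuous_measurable_rV (cq k))))
  ((@measurable_EFinP _ _ _ _ _).2 (continuous_measurable_rV cG))
  (aeW _ (fun x _ => qG x)) (integrable_cube N C _)
  (aeW _ (fun x k _ => qbound k x)).
under eq_fun do rewrite intq.
move=> /cvg_unique; apply => //; exact: cvg_cst.
Unshelve. all: by end_near. Qed.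

End dilation.

(** * Radial vector fields and the energy identity *)

Section radial_field.
Context {R : realType} {N : nat}.
Variable K : set 'rV[R]_N.
Hypotheses (K_body : convex_body K) (K_o : interior K 0) (K_smooth : smooth_body K).
Local Notation g := (minkowski_functional K).

Lemma gauge_radial_is_derive x : x != 0 -> is_derive x x g (g x).
Proof.
move=> x0; have [p px dg] := gauge_is_derive K_body K_o K_smooth x0.
by have := dg x; rewrite px.
Qed.

Lemma is_derive_div_id (H : R -> R) (r d : R) : r != 0 -> is_derive r 1 H d ->
  is_derive r 1 (fun s => H s / s) (d / r - H r / r ^+ 2).
Proof.
move=> r0 dH; have dV := is_deriveV r0 (is_derive_id r 1).
have -> : d / r - H r / r ^+ 2 = H r *: (- r ^- 2 *: 1) + r^-1 *: d.
  by rewrite /GRing.scale/= mulr1 mulrN mulrC addrC.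
exact: is_deriveM.
Qed.

(** In terms of phi r = H r / r the field is phi(g) x and the right-hand side is
    g phi'(g) + N phi(g); the sum of x_i times the i-th partial derivative of g is
    g by Euler's identity. *)
Lemma divergence_radial (H : R -> R) x (d : R) : x != 0 ->
  is_derive (g x) 1 H d ->
  divergence (fun y => H (g y) *: sigma_body K y) x = d + (N%:R - 1) * H (g x) / g x.
Proof.
move=> x0 dH; have gx : g x != 0 by rewrite gt_eqF// gauge_gt0.
have [p px dg] := gauge_is_derive K_body K_o K_smooth x0.
have dphi := is_derive_div_id gx dH.
set dp := (X in is_derive _ _ _ X) in dphi.
transitivity (\sum_(i < N) (dp * (p ord0 i * x ord0 i) + H (g x) / g x)).
  apply: eq_bigr => i _; rewrite /partial.
  have dcomp := is_derive_comp (dg (basis_vec i)) dphi.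
  rewrite dotv_basis in dcomp.
  have dcoord : is_derive x (basis_vec i) (fun y : 'rV[R]_N => y ord0 i) 1.
    apply/is_derive_line0.
    have -> : (fun t : R => (x + t *: basis_vec i : 'rV[R]_N) ord0 i) = cst (x ord0 i) + id.
      by apply/funext => t; rewrite fctE !mxE !eqxx mulr1.
    by rewrite -[X in is_derive _ _ _ X]add0r; exact: is_deriveD.
  have -> : (fun y => (H (g y) *: sigma_body K y) ord0 i) =
      ((fun s => H s / s) \o g) * (fun y => y ord0 i).
    by apply/funext => y; rewrite /sigma_body scalerA mxE fctE.
  have [_ ->] := is_deriveM dcomp dcoord.
  by rewrite /GRing.scale/= mulr1; ring.
rewrite big_split/= -mulr_sumr [\sum_(i < N) _ * _]px sumr_const card_ord -mulr_natl.
by rewrite /dp; field.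
Qed.

End radial_field.

Section radial_energy.
Context {R : realType} {N : nat}.
Variable K : set 'rV[R]_N.
Hypotheses (K_body : convex_body K) (K_o : interior K 0) (K_smooth : smooth_body K).
Variables (rho : \bar R) (A B H : R -> R).
Hypotheses (A_C1 : C1_on rho A) (B_C1 : C1_on rho B) (H_C1 : C1_on rho H).
Hypothesis (H_eq : forall r : R, 0 < r -> (r%:E < rho)%E -> H r = A r * B r).
Variable u : 'rV[R]_N -> R.
Hypothesis u_Cc : Cc_infty (body_ball K rho `\ 0) u.
Local Notation g := (minkowski_functional K).
Local Notation S := (support_of u).

Let Du x := dotv (gradient u x) x.

Let divH x := derive1 H (g x) + (N%:R - 1) * H (g x) / g x.

Let supp_closed : closed S.
Proof. exact: closed_closure. Qed.

Let supp_range x : S x -> [/\ x != 0, 0 < g x & ((g x)%:E < rho)%E].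
Proof.
by case: u_Cc => _ _ /[apply] -[gx /eqP x0]; split => //; exact: gauge_gt0.
Qed.

Let u0 x : ~ S x -> u x = 0.
Proof.
by move=> Sx; apply/eqP; apply: contra_notT Sx => ux; exact: subset_closure.
Qed.

Let u_near0 x : ~ S x -> \forall y \near x, u y = 0.
Proof.
move=> Sx; have : nbhs x (~` S) by apply: open_nbhs_nbhs; split => //; exact: closed_openC.
by apply: filterS => y /u0.
Qed.

Let u_C1 : class_Ck 1 u.
Proof. by case: u_Cc. Qed.

Let u_is_derive x v : is_derive x v u (dotv (gradient u x) v).
Proof. exact: class_C1_is_derive. Qed.

Let Du0 x : ~ S x -> Du x = 0.
Proof.
move=> /u_near0 nu; have [_ du] := u_is_derive x x.
by rewrite /Du -du (near_eq_derive (g := cst 0) _ nu) derive_cst.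
Qed.

Let cu : continuous u.
Proof. by case: u_C1. Qed.

Let cDu : continuous Du.
Proof.
move=> x; rewrite /Du /dotv; elim: (index_enum 'I_N) => [|i s IH].
  under eq_fun do rewrite big_nil.
  exact: continuous_for_cst.
under eq_fun do rewrite big_cons.
apply: (continuous_forD _ IH).
apply: continuous_forM; last exact: coord_continuous.
have -> : (fun y => gradient u y ord0 i) = partial i u by apply/funext => y; rewrite mxE.
by have [_ [_ /(_ i)[cp _]]] := u_C1; exact: cp.
Qed.

Let cg x : {for x, continuous g}.
Proof. exact: gauge_continuous. Qed.

Let profile_continuous (P : R -> R) x : C1_on rho P -> S x -> {for x, continuous (P \o g)}.
Proof.
move=> PC /supp_range[_ gx gr]; have [dP _] := PC _ gx gr.
apply: continuous_comp; first exact: cg.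
exact: is_derive_continuous (derivableP dP).
Qed.

Let gV_continuous x : S x -> {for x, continuous (fun y => (g y)^-1)}.
Proof.
move=> /supp_range[_ gx _]; apply: continuousV; first by rewrite gt_eqF.
exact: cg.
Qed.

Let divH_continuous x : S x -> {for x, continuous divH}.
Proof.
move=> Sx; have [_ gx gr] := supp_range Sx.
apply: continuous_forD.
  apply: (@continuous_comp _ _ _ g (derive1 H)); first exact: cg.
  by case: (H_C1 gx gr).
apply: continuous_forM (gV_continuous Sx).
by apply: (continuous_forM (continuous_for_cst _ x)); exact: profile_continuous.
Qed.

Let divergenceE x : S x ->
  divergence (fun y => H (g y) *: sigma_body K y) x = divH x.
Proof.
move=> /supp_range[x0 gx gr]; have [dH _] := H_C1 gx gr.
have dH1 : is_derive (g x) 1 H (derive1 H (g x)).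
  by rewrite derive1E; exact: derivableP.
exact: divergence_radial dH1.
Qed.

Let cross x := divH x * u x ^+ 2 + 2 * (H (g x) / g x) * u x * Du x.

(** With phi r = H r / r and f = phi(g) u^2, the cross term is N f + F, where F is
    the derivative of f in the direction x at x. *)
Lemma integral_cross_term : (\int[lebesgue_rV N]_x (cross x)%:E = 0)%E.
Proof.
pose phi s := H s / s.
pose f x := phi (g x) * (u x * u x).
pose F x := (derive1 H (g x) - phi (g x)) * (u x * u x) + 2 * phi (g x) * (u x * Du x).
have fF x : cross x = N%:R * f x + F x by rewrite /cross /divH /f /F /phi; ring.
under eq_integral do rewrite fF.
have cphi x : S x -> {for x, continuous (fun y => phi (g y))}.
  by move=> Sx; apply: continuous_forM (gV_continuous Sx); exact: profile_continuous.
have f0 x : ~ S x -> f x = 0 by move=> /u0 ux; rewrite /f ux mul0r mulr0.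
have F0 x : ~ S x -> F x = 0 by move=> /u0 ux; rewrite /F ux !mul0r !mulr0 addr0.
apply: (@integral_dilation_derivative _ _ f F S) => //.
- by case: u_Cc.
- apply: (continuous_closed_support _ f0) => // x Sx.
  by apply: continuous_forM (cphi _ Sx) (continuous_forM _ _); exact: cu.
- apply: (continuous_closed_support _ F0) => // x Sx.
  have [_ gx gr] := supp_range Sx; have [_ cH] := H_C1 gx gr.
  apply: continuous_forD; apply: continuous_forM.
  + apply: continuous_forB (cphi _ Sx).
    exact: (@continuous_comp _ _ _ g (derive1 H)) (@cg x) cH.
  + by apply: continuous_forM; exact: cu.
  + exact: continuous_forM (continuous_for_cst _ x) (cphi _ Sx).
  + by apply: continuous_forM; [exact: cu|exact: cDu].
- move=> x; have [Sx|nSx] := pselect (S x); last first.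
    rewrite F0//; apply: near_eq_is_derive (is_derive_cst (0 : R) x x).
    by apply: filterS (u_near0 nSx) => y uy; rewrite /f uy mul0r mulr0.
  have [x0 gx gr] := supp_range Sx; have [dH _] := H_C1 gx gr.
  have dphi : is_derive (g x) 1 phi (derive1 H (g x) / g x - H (g x) / g x ^+ 2).
    by apply: is_derive_div_id; rewrite ?gt_eqF// derive1E; exact: derivableP.
  have dg := gauge_radial_is_derive K_body K_o K_smooth x0.
  have du : is_derive x x u (Du x) by exact: u_is_derive.
  have -> : f = (phi \o g) * (u * u) by apply/funext => y; rewrite !fctE.
  have dM := is_deriveM (is_derive_comp dg dphi) (is_deriveM du du).
  set d := (X in is_derive _ _ _ X) in dM.
  suff <- : d = F x by [].
  rewrite /d /F /GRing.scale/= fctE /phi; field.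
  by rewrite gt_eqF.
Qed.

Let radialE x : radial_derivative K u x = (g x)^-1 * Du x.
Proof. by rewrite /radial_derivative /sigma_body dotvZr. Qed.

Let integral_body (f : 'rV[R]_N -> R) : (forall x, ~ S x -> f x = 0) ->
  (\int[lebesgue_rV N]_(x in body_ball K rho) (f x)%:E =
   \int[lebesgue_rV N]_x (f x)%:E)%E.
Proof.
move=> f0; rewrite integral_mkcond; apply: eq_integral => x _.
rewrite patchE; case: ifPn => // /negP; rewrite inE => xD.
by rewrite f0// => Sx; apply: xD; have [_ _] := supp_range Sx.
Qed.

(** Pointwise the three integrands f1, f2, f3 satisfy f2 + f3 - f1 = cross: on the
    support of u by expanding the square and using H = A B, elsewhere because
    everything vanishes. *)
Lemma radial_energy_identity :
  (\int[lebesgue_rV N]_(x in body_ball K rho)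
     (A (g x) ^+ 2 * `|radial_derivative K u x| ^+ 2)%:E
   = \int[lebesgue_rV N]_(x in body_ball K rho)
       ((divergence (fun y => H (g y) *: sigma_body K y) x - B (g x) ^+ 2) * u x ^+ 2)%:E
   + \int[lebesgue_rV N]_(x in body_ball K rho)
       (`|A (g x) * radial_derivative K u x + B (g x) * u x| ^+ 2)%:E)%E.
Proof.
have cS : compact S by case: u_Cc.
pose Ru x := (g x)^-1 * Du x.
pose f1 x := A (g x) * A (g x) * (Ru x * Ru x).
pose f2 x := (divH x - B (g x) * B (g x)) * (u x * u x).
pose w x := A (g x) * Ru x + B (g x) * u x.
pose f3 x := w x * w x.
have f2E x : (divergence (fun y => H (g y) *: sigma_body K y) x - B (g x) ^+ 2) * u x ^+ 2
    = f2 x.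
  have [Sx|/u0 ux] := pselect (S x); first by rewrite divergenceE.
  by rewrite /f2 ux expr0n/= mulr0 !mul0r mulr0.
under eq_integral do rewrite radialE real_normK ?num_real// !expr2 -/(Ru _) -/(f1 _).
under [X in (_ = X + _)%E]eq_integral do rewrite f2E.
under [X in (_ = _ + X)%E]eq_integral do
  rewrite radialE real_normK ?num_real// expr2 -/(Ru _) -/(w _) -/(f3 _).
have f10 x : ~ S x -> f1 x = 0 by move=> /Du0 Dux; rewrite /f1 /Ru Dux !mulr0.
have f20 x : ~ S x -> f2 x = 0 by move=> /u0 ux; rewrite /f2 ux !mulr0.
have f30 x : ~ S x -> f3 x = 0.
  by move=> nSx; rewrite /f3 /w /Ru (u0 nSx) (Du0 nSx) !mulr0 addr0 mulr0.
have cross0 x : ~ S x -> cross x = 0.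
  by move=> nSx; rewrite /cross (u0 nSx) expr0n/= !mulr0 !mul0r addr0.
rewrite !integral_body//.
have cA x : S x -> {for x, continuous (fun y => A (g y))}.
  by move=> Sx; exact: profile_continuous.
have cB x : S x -> {for x, continuous (fun y => B (g y))}.
  by move=> Sx; exact: profile_continuous.
have cR x : S x -> {for x, continuous Ru}.
  by move=> Sx; apply: continuous_forM (gV_continuous Sx) _; exact: cDu.
have cu2 x : {for x, continuous (fun y => u y * u y)}.
  by apply: continuous_forM; exact: cu.
have i1 : (lebesgue_rV N).-integrable setT (fun x => (f1 x)%:E).
  apply: (compact_support_integrable _ cS f10).
  apply: (continuous_closed_support _ f10) => // x Sx.
  apply: continuous_forM; apply: continuous_forM; by [exact: cA|exact: cR].
have i2 : (lebesgue_rV N).-integrable setT (fun x => (f2 x)%:E).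
  apply: (compact_support_integrable _ cS f20).
  apply: (continuous_closed_support _ f20) => // x Sx.
  apply: continuous_forM (cu2 x); apply: continuous_forB (divH_continuous Sx) _.
  by apply: continuous_forM; exact: cB.
have i3 : (lebesgue_rV N).-integrable setT (fun x => (f3 x)%:E).
  apply: (compact_support_integrable _ cS f30).
  apply: (continuous_closed_support _ f30) => // x Sx.
  have cw : {for x, continuous w}.
    apply: continuous_forD; apply: continuous_forM.
    + exact: cA. + exact: cR. + exact: cB. + exact: cu.
  exact: continuous_forM.
have pointwise x : cross x = f2 x + f3 x - f1 x.
  have [Sx|nSx] := pselect (S x); last by rewrite cross0// f10// f20// f30// addr0 subr0.
  have [_ gx gr] := supp_range Sx.
  rewrite /cross /f1 /f2 /f3 /w /Ru (H_eq gx gr); field.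
  by rewrite gt_eqF.
have := integral_cross_term.
under eq_integral do rewrite pointwise EFinB EFinD.
rewrite integralB//; last exact: integrableD.
rewrite integralD//.
have /fineK <- := integrable_fin_num measurableT i1.
have /fineK <- := integrable_fin_num measurableT i2.
have /fineK <- := integrable_fin_num measurableT i3.
rewrite -!EFinD => -[] /eqP; rewrite subr_eq0 => /eqP ->.
by [].
Qed.

End radial_energy.

Theorem theorem3p1 (R : realType) (N : nat) (N_ge2 : (2 <= N)%N)
    (K : set 'rV[R]_N) (K_ss : Kss_o K)
    (rho : \bar R) (rho_gt0 : (0 < rho)%E)
    (A B H : R -> R)
    (A_C1 : C1_on rho A) (B_C1 : C1_on rho B) (H_C1 : C1_on rho H)
    (H_eq : forall r : R, 0 < r -> (r%:E < rho)%E -> H r = A r * B r)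
    (u : 'rV[R]_N -> R) (u_Cc : Cc_infty (body_ball K rho `\ 0) u) :
  (\int[lebesgue_rV N]_(x in body_ball K rho)
     (A (minkowski_functional K x) ^+ 2 * `|radial_derivative K u x| ^+ 2)%:E
   = \int[lebesgue_rV N]_(x in body_ball K rho)
       ((divergence
           (fun y => H (minkowski_functional K y) *: sigma_body K y) x
         - B (minkowski_functional K x) ^+ 2) * u x ^+ 2)%:E
   + \int[lebesgue_rV N]_(x in body_ball K rho)
       (`|A (minkowski_functional K x) * radial_derivative K u x
          + B (minkowski_functional K x) * u x| ^+ 2)%:E)%E.
Proof.
have [K_body K_o K_smooth _] := K_ss.
exact: radial_energy_identity.
Qed.
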